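(* Let $\mathbf H_n = (H_n^{(1)}, H_n^{(2)})$, $n\ge1$, be a sequence of 2-multiplexes. Suppose the vertices of $\mathbf H_n$ are colored uniformly at random with $c_n$ colors, where $c_n\to\infty$, such that $$\lim_{n \to \infty} \frac{|E(H_n^{(1)})|}{c_n} = \lambda_1,\qquad \lim_{n \to \infty} \frac{|E(H_n^{(2)})|}{c_n} = \lambda_2,\qquad \lim_{n \to \infty} \frac{|E(H_n^{(1)}) \cap E(H_n^{(2)})|}{c_n} = \lambda_{1,2},$$ for constants $\lambda_1, \lambda_2, \lambda_{1,2} \geq 0$ with $\lambda_{1,2} \le \lambda_1$ and $\lambda_{1,2} \le \lambda_2$. Then, as $n\to\infty$, $\mathbf T(\mathbf H_n)=(T(H_n^{(1)}),T(H_n^{(2)}))^\top$ converges in distribution to $$\begin{pmatrix} Z_1 + Z_{1,2} \\ Z_2 + Z_{1,2} \end{pmatrix},$$ where $Z_1 \sim \mathrm{Pois}(\lambda_1 - \lambda_{1,2})$, $Z_2 \sim \mathrm{Pois}(\lambda_2 - \lambda_{1,2})$, and $Z_{1,2} \sim \mathrm{Pois}(\lambda_{1,2})$ are independent.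
   Context: A 2-multiplex is a pair $(H_n^{(1)},H_n^{(2)})$ of finite simple graphs on a common vertex set $V_n$. ''Colored uniformly at random with $c_n$ colors'' means each $v\in V_n$ gets a color $X_v$ uniform on $\{1,\dots,c_n\}$, independently over the vertices (a single coloring is used for both graphs). $T(H_n^{(i)})$ is the number of edges of $H_n^{(i)}$ whose two endpoints have the same color. $\mathrm{Pois}(0)$ is the point mass at $0$. *)

(* Defs.v *)
From HB Require Import structures.
From mathcomp Require Import all_boot all_order all_algebra.
From mathcomp Require Import all_classical all_reals all_analysis.

Set Implicit Arguments.
Unset Strict Implicit.
Unset Printing Implicit Defensive.

Import Order.TTheory GRing.Theory Num.Theory.
Import numFieldNormedType.Exports.

Record sgraph (V : finType) := SGraph {
  adj : rel V ;
  adj_sym : symmetric adj ;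
  adj_irr : irreflexive adj }.

(* Edges are unordered: an edge is the 2-element set of its endpoints. *)
Definition edges (V : finType) (G : sgraph V) : {set {set V}} :=
  ([set [set p.1; p.2] | p : V * V & adj G p.1 p.2])%SET.

Record multiplex2 := Multiplex2 {
  vertices : finType ;
  layer1 : sgraph vertices ;
  layer2 : sgraph vertices }.

Definition mono_edges (V : finType) (G : sgraph V) (x : V -> nat) : nat :=
  #|[set e in edges G | [forall u in e, forall v in e, x u == x v]]%SET|.

Local Open Scope classical_set_scope.
Local Open Scope ring_scope.

Definition mutually_independent d d' (T : measurableType d)
    (T' : measurableType d') (R : realType) (P : probability T R)
    (I : finType) (X : I -> {RV P >-> T'}) : Prop :=
  forall (J : {set I}) (B : I -> set T'), (forall i, measurable (B i)) ->
    P (\bigcap_(i in [set` J]) (X i @^-1` B i)) =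
    (\prod_(i in J) P (X i @^-1` B i))%E.

Definition uniform_color d (T : measurableType d) (R : realType)
    (P : probability T R) (c : nat) (X : {RV P >-> nat}) : Prop :=
  forall k : nat, distribution P X [set k] =
    (if (1 <= k <= c)%N then (c%:R^-1)%:E else 0%:E).

Definition uniform_coloring d (T : measurableType d) (R : realType)
    (P : probability T R) (V : finType) (c : nat)
    (X : V -> {RV P >-> nat}) : Prop :=
  (forall v, uniform_color c (X v)) /\ mutually_independent X.

(* The last argument of [poisson_prob] is a dummy: the measure does not depend
   on it.  For [rate = 0] the library defines it to be the Dirac mass at 0. *)
Definition is_poisson d (T : measurableType d) (R : realType)
    (P : probability T R) (rate : R) (Z : {RV P >-> nat}) : Prop :=
  distribution P Z = poisson_prob rate 0%N.

(* Weak convergence of the laws of [X n] to the law of [Y], tested on bounded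
   continuous functions; the variables may live on different spaces.  It is
   meant for Borel measurable [X n] and [Y]. *)
Definition cvg_in_distribution (R : realType) (E : topologicalType)
    (d : nat -> measure_display) (T : forall n, measurableType (d n))
    (P : forall n, probability (T n) R) (X : forall n, T n -> E)
    (d' : measure_display) (T' : measurableType d') (P' : probability T' R)
    (Y : T' -> E) : Prop :=
  forall f : E -> R, continuous f -> (exists M : R, forall x, `|f x| <= M) ->
    ('E_(P n)[f \o X n])%E @[n --> \oo] --> ('E_P'[f \o Y])%E.

(* Main.v *)
Require Import Defs.
From HB Require Import structures.
From mathcomp Require Import all_boot all_order all_algebra.
From mathcomp Require Import all_classical all_reals all_analysis.
From mathcomp Require Import ring lra zify.

Set Implicit Arguments.
Unset Strict Implicit.
Unset Printing Implicit Defensive.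

Import Order.TTheory GRing.Theory Num.Theory.
Import numFieldNormedType.Exports.
Local Open Scope classical_set_scope.
Local Open Scope ring_scope.

(** List the vertices by increasing degree and colour them in the reverse
    order.  When [v] is coloured, only its neighbours listed after it matter;
    they all have degree at least that of [v], hence at least their own number
    [d], so [d ^ 2] is at most the sum of the degrees, [2 m] for [m] edges
    ([backdegree_sorted]).

    Give each edge the mark [(1,0,0)], [(0,1,0)] or [(0,0,1)] according to
    whether it belongs to the first layer only, to the second only, or to both.
    The sum of the marks of the monochromatic edges determines both counts of
    monochromatic edges.  Compare its law with that of the sum of the marks
    kept by independent Bernoulli trials with success probability [p = 1 / c],
    one per edge, replacing one vertex at a time.  Given the earlier colours,
    the contributions of the [d] edges that [v] closes differ from independent
    ones only when two of the neighbours share a colour, or when two trials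
    succeed.  Each of these costs [O (p ^ 2 d ^ 2)] for a bounded test function
    ([attach_vertex]).  The sum of the [d]s is [m] and each of them is at most
    [sqrt (2 m)], so the total error is [O (p ^ 2 m sqrt (2 m))]
    ([lindeberg_edges]); it vanishes when [m] is of order [c].  The order is
    what handles a star: its centre has degree [m], but it is coloured first, so
    that all backdegrees are at most 1.

    For independent trials the three coordinates are independent binomial
    variables ([thins_tensor], [iter_thin_pmf]), whose masses converge to
    Poisson masses ([cvg_binomial_poisson]).  Masses that converge to those of
    a probability law on a countable set imply convergence of the expectations
    of all bounded functions ([cvg_discrete_laws]), in particular of
    the continuous functions of the two counts. *)

(** * Uniform averages over finite types *)

Section UniformAverage.
Variable R : realType.

Definition avg (I : finType) (F : I -> R) : R := #|I|%:R^-1 * \sum_i F i.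

Lemma eq_avg (I : finType) (F G : I -> R) : F =1 G -> avg F = avg G.
Proof. by move=> FG; congr (_ * _); apply: eq_bigr => i _; exact: FG. Qed.

Lemma avgD (I : finType) (F G : I -> R) :
  avg (fun i => F i + G i) = avg F + avg G.
Proof. by rewrite /avg big_split mulrDr. Qed.

Lemma avgB (I : finType) (F G : I -> R) :
  avg (fun i => F i - G i) = avg F - avg G.
Proof. by rewrite /avg sumrB mulrBr. Qed.

Lemma avgZ (I : finType) (a : R) (F : I -> R) :
  avg (fun i => a * F i) = a * avg F.
Proof. by rewrite /avg -mulr_sumr mulrCA. Qed.

Lemma avg_sum (I : finType) (J : Type) (r : seq J) (F : J -> I -> R) :
  avg (fun i => \sum_(j <- r) F j i) = \sum_(j <- r) avg (F j).
Proof. by rewrite /avg exchange_big mulr_sumr. Qed.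

Lemma avg_cst (I : finType) (a : R) : (0 < #|I|)%N -> avg (fun _ : I => a) = a.
Proof.
move=> I0; rewrite /avg sumr_const -[a *+ _]mulr_natl mulrA mulVf ?mul1r //.
by rewrite pnatr_eq0 -lt0n.
Qed.

(** Averaging against the indicator of one point: the tool that turns averages
    over a fresh colour into sums over neighbours. *)
Lemma avg_pred1 (I : finType) (i : I) (F : I -> R) :
  avg (fun j => (i == j)%:R * F j) = #|I|%:R^-1 * F i.
Proof.
congr (_ * _); rewrite (bigD1 i) //= eqxx mul1r big1 ?addr0 // => j ji.
by rewrite eq_sym (negbTE ji) mul0r.
Qed.

Lemma ler_avg (I : finType) (F G : I -> R) :
  (forall i, F i <= G i) -> avg F <= avg G.
Proof. by move=> FG; rewrite ler_wpM2l ?invr_ge0// ler_sum. Qed.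

Lemma ler_norm_avg (I : finType) (F : I -> R) :
  `|avg F| <= avg (fun i => `|F i|).
Proof.
rewrite normrM ger0_norm ?invr_ge0// ler_wpM2l ?invr_ge0//.
exact: ler_norm_sum.
Qed.

Variables (V C : finType).

Definition recolor (x : {ffun V -> C}) (v : V) (j : C) : {ffun V -> C} :=
  [ffun w => if w == v then j else x w].

Lemma recolor_same x v j : recolor x v j v = j.
Proof. by rewrite ffunE eqxx. Qed.

Lemma recolor_other x v j w : w != v -> recolor x v j w = x w.
Proof. by rewrite ffunE => /negbTE ->. Qed.

(** Resampling the colour of [v] leaves the uniform law invariant: exchanging
    the old colour of [v] with the fresh colour [j] is an involution of the
    pairs (colouring, colour). *)
Lemma avg_recolor (v : V) (F : {ffun V -> C} -> R) : (0 < #|C|)%N ->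
  avg F = avg (fun x => avg (fun j => F (recolor x v j))).
Proof.
move=> C0; rewrite {1 2}/avg; congr (_ * _).
rewrite /avg -mulr_sumr pair_big /=.
pose h (q : {ffun V -> C} * C) := (recolor q.1 v q.2, q.1 v).
have hK : involutive h.
  move=> [x j]; rewrite /h /= recolor_same; congr (_, _).
  by apply/ffunP => w; rewrite !ffunE; case: eqP => [->|].
rewrite (reindex_inj (inv_inj hK)) /=.
rewrite (eq_bigr (fun q => F q.1)); last first.
  move=> [x j] _ /=; congr F.
  by apply/ffunP => w; rewrite !ffunE; case: eqP => [->|]; rewrite ?eqxx.
rewrite -(pair_big xpredT xpredT (fun x (j : C) => F x)) /=.
rewrite [in RHS](eq_bigr (fun x => #|C|%:R * F x)); last first.
  by move=> x _; rewrite sumr_const -[F x *+ _]mulr_natl.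
by rewrite -mulr_sumr mulrA mulVf ?mul1r // pnatr_eq0 -lt0n.
Qed.

Lemma avg_same_color (u v : V) : u != v -> (0 < #|C|)%N ->
  avg (fun x : {ffun V -> C} => (x u == x v)%:R) = #|C|%:R^-1.
Proof.
move=> uv C0; rewrite (avg_recolor v) //.
rewrite -[RHS](@avg_cst {ffun V -> C} _); last first.
  by rewrite card_ffun expn_gt0 C0.
apply: eq_avg => x; rewrite -[RHS]mulr1 -(avg_pred1 (x u) (fun=> 1)).
by apply: eq_avg => j; rewrite recolor_same recolor_other// mulr1.
Qed.

End UniformAverage.

(** * Adding independent Bernoulli multiples of given marks *)

Section Thinning.
Variables (R : realType) (S : nmodType) (p : R).

(** The expectation of [f (s + b t)] over a Bernoulli variable [b] with success
    probability [p], as an operator on test functions. *)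
Definition thin (t : S) (f : S -> R) (s : S) : R :=
  (1 - p) * f s + p * f (s + t).

Definition thins (ts : seq S) (f : S -> R) : S -> R :=
  foldl (fun g t => thin t g) f ts.

Lemma thins_cat ts1 ts2 f : thins (ts1 ++ ts2) f = thins ts2 (thins ts1 f).
Proof. exact: foldl_cat. Qed.

Hypothesis p01 : 0 <= p <= 1.

Lemma thin_bounded t f (M : R) :
  (forall s, `|f s| <= M) -> forall s, `|thin t f s| <= M.
Proof.
move=> fM s; have /andP[p0 p1] := p01.
rewrite (le_trans (ler_normD _ _))// !normrM (ger0_norm p0).
rewrite ger0_norm ?subr_ge0//.
have := ler_wpM2l p0 (fM (s + t)).
have : (1 - p) * `|f s| <= (1 - p) * M by rewrite ler_wpM2l// subr_ge0.
lra.
Qed.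

Lemma thins_bounded ts f (M : R) :
  (forall s, `|f s| <= M) -> forall s, `|thins ts f s| <= M.
Proof.
elim: ts f => //= t ts IH f fM; apply: IH; exact: thin_bounded.
Qed.

End Thinning.

(** * Attaching one vertex *)

Section Lindeberg.
Variables (R : realType) (V C : finType) (S : nmodType).
Hypothesis C_gt0 : (0 < #|C|)%N.
Let p : R := #|C|%:R^-1.

Let p01 : 0 <= p <= 1.
Proof. by rewrite invr_ge0 ler0n /= invf_le1 ?ltr0n// ler1n. Qed.

Let coloring_gt0 : (0 < #|{ffun V -> C}|)%N.
Proof. by rewrite card_ffun expn_gt0 C_gt0. Qed.

(** The increment of [f] along [t] is unchanged by a shift [n] that vanishes; in
    all other cases [k >= 1] and the crude bound [4 M] suffices.  Below, [n] sums
    the marks of [k] neighbours. *)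
Lemma increment_gap (t : S) (f : S -> R) (M : R) (b n : S) (k : nat) :
  (forall s, `|f s| <= M) -> (k = 0%N -> n = 0) ->
  `|(f (b + n + t) - f (b + n)) - (f (b + t) - f b)| <= 4 * M * k%:R.
Proof.
move=> fM; case: k => [->//|k _]; first by rewrite addr0 subrr normr0 mulr0.
have M0 : 0 <= M by apply: le_trans (fM b).
have le4 : 4 * M <= 4 * M * k.+1%:R by rewrite ler_peMr ?ler1n ?mulr_ge0.
apply: le_trans le4.
have := fM (b + n + t); have := fM (b + n); have := fM (b + t); have := fM b.
by rewrite !ler_norml; lra.
Qed.

(** The fresh colour [j] equals [x u] with probability [p].  So, up to the factor
    [p], the difference compares the increment of [f] along [t u] taken at the
    colour [x u] with its average over all colours.  Both are close to
    the increment at [b], and the error counts the neighbours in [N] that have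
    the colour in question. *)
Lemma attach_one (N : seq V) (u : V) (t : V -> S) (f : S -> R) (M : R)
    (b : S) (x : {ffun V -> C}) :
  (forall s, `|f s| <= M) ->
  `|avg (fun j => f (b + \sum_(w <- u :: N | x w == j) t w)) -
    avg (fun j => thin p (t u) f (b + \sum_(w <- N | x w == j) t w))|
  <= 4 * M * p * (\sum_(w <- N) (x w == x u)%:R + p * (size N)%:R).
Proof.
move=> fM; have /andP[p0 p1] := p01.
pose n j := \sum_(w <- N | x w == j) t w.
pose D s := f (s + t u) - f s.
have -> : avg (fun j => f (b + \sum_(w <- u :: N | x w == j) t w)) =
    avg (fun j => f (b + n j)) + p * D (b + n (x u)).
  rewrite -(avg_pred1 (x u) (fun j => D (b + n j))) -avgD.
  apply: eq_avg => j; rewrite big_cons.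
  case: eqP => _; last by rewrite mul0r addr0.
  by rewrite mul1r /D addrCA [t u + _]addrC addrA; ring.
have -> : avg (fun j => thin p (t u) f (b + \sum_(w <- N | x w == j) t w)) =
    avg (fun j => f (b + n j)) + p * avg (fun j => D (b + n j)).
  by rewrite -avgZ -avgD; apply: eq_avg => j; rewrite /thin /D -/(n j); ring.
have -> : forall a y z : R, a + p * y - (a + p * z) = p * (y - z).
  by move=> *; ring.
rewrite normrM (ger0_norm p0) [4 * M * p]mulrC -mulrA ler_wpM2l//.
pose k j := count (fun w => x w == j) N.
have gap j : `|D (b + n j) - D b| <= 4 * M * (k j)%:R.
  apply: increment_gap => // /eqP.
  rewrite /k -leqn0 leqNgt -has_count => /hasPn no.
  by rewrite /n big_seq_cond big1// => w /andP[/no/negbTE ->].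
have kE j : (k j)%:R = \sum_(w <- N) (x w == j)%:R :> R.
  by rewrite /k -sum1_count natr_sum big_mkcond; apply: eq_bigr => w _; case: eqP.
have -> : D (b + n (x u)) - avg (fun j => D (b + n j)) =
    (D (b + n (x u)) - D b) - avg (fun j => D (b + n j) - D b).
  by rewrite avgB avg_cst//; ring.
apply: le_trans (ler_normB _ _) _; rewrite mulrDr lerD//.
  by rewrite -kE; exact: gap.
apply: le_trans (ler_norm_avg _) _; apply: le_trans (ler_avg gap) _.
rewrite avgZ ler_wpM2l ?mulr_ge0//; first exact: le_trans (fM b).
have -> : avg (fun j => (k j)%:R) = \sum_(w <- N) p.
  rewrite (eq_avg kE) avg_sum; apply: eq_bigr => w _.
  rewrite -[RHS]mulr1 -(avg_pred1 (x w) (fun=> 1)).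
  by apply: eq_avg => j; rewrite mulr1.
by rewrite big_const_seq count_predT iter_addr_0 mulr_natr.
Qed.

(** Here [b] collects the marks of the edges closed earlier.  Replacing the
    edges to [N] by Bernoulli trials one at a time, [attach_one] is averaged over
    the colouring: distinct vertices share a colour with probability [p], so the
    edge to [u] costs [8 M p ^ 2] times the number of remaining edges. *)
Lemma attach_vertex (N : seq V) (t : V -> S) (f : S -> R) (M : R)
    (b : {ffun V -> C} -> S) :
  uniq N -> (forall s, `|f s| <= M) ->
  `|avg (fun x => avg (fun j => f (b x + \sum_(w <- N | x w == j) t w))) -
    avg (fun x => thins p (map t N) f (b x))|
  <= 4 * M * p ^+ 2 * (size N)%:R ^+ 2.
Proof.
have /andP[p0 p1] := p01.
elim: N f => [f _ fM|u N IH f /= /andP[uN uniqN] fM].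
  rewrite [X in `|X - _|](_ : _ = avg (fun x => f (b x))).
    by rewrite subrr normr0 expr0n mulr0.
  apply: eq_avg => x; rewrite -[RHS](@avg_cst R C _)//.
  by apply: eq_avg => j; rewrite big_nil addr0.
have M0 : 0 <= M by exact: le_trans (fM 0).
have {}IH := IH _ uniqN (thin_bounded p01 (t u) fM).
have step : `|avg (fun x => avg (fun j =>
      f (b x + \sum_(w <- u :: N | x w == j) t w))) -
    avg (fun x => avg (fun j =>
      thin p (t u) f (b x + \sum_(w <- N | x w == j) t w)))|
    <= 4 * M * p * (p * (size N)%:R + p * (size N)%:R).
  rewrite -avgB; apply: le_trans (ler_norm_avg _) _.
  apply: (le_trans (ler_avg (fun x => attach_one N u t (b x) x fM))).
  rewrite avgZ avgD avg_sum avg_cst// (_ : \sum_(w <- N) _ = p * (size N)%:R)//.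
  rewrite [RHS]mulr_natr -iter_addr_0 -count_predT -big_const_seq.
  rewrite !big_seq; apply: eq_bigr => w wN; apply: avg_same_color => //.
  by apply: contra uN => /eqP <-.
apply: le_trans (ler_distD _ _ _) (le_trans (lerD step IH) _).
have := mulr_ge0 M0 (exprn_ge0 2 p0).
rewrite -natr1.
set m := (size N)%:R; set q := M * _ => q0.
nra.
Qed.

End Lindeberg.

(** * Edges as pairs of a listing of the vertices *)

Section Pairs.

Fixpoint pairs (T : Type) (s : seq T) : seq (T * T) :=
  if s is v :: s' then [seq (v, u) | u <- s'] ++ pairs s' else [::].

Lemma mem_pairs (T : eqType) (s : seq T) e :
  e \in pairs s -> (e.1 \in s) && (e.2 \in s).
Proof.
elim: s => //= v s IH; rewrite mem_cat => /orP[/mapP[u us ->]|/IH/andP[e1 e2]].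
  by rewrite !inE eqxx us orbT.
by rewrite !inE e1 e2 !orbT.
Qed.

Lemma pairs_total (T : eqType) (s : seq T) a b :
  a \in s -> b \in s -> a != b -> ((a, b) \in pairs s) || ((b, a) \in pairs s).
Proof.
elim: s => //= v s IH; rewrite !inE !mem_cat.
case/predU1P => [->|sa] /predU1P[->|sb] ab.
- by rewrite eqxx in ab.
- by rewrite map_f.
- by rewrite [(v, a) \in map _ _]map_f// !orbT.
- by case/orP: (IH sa sb ab) => ->; rewrite ?orbT.
Qed.

(** Forgetting the orientation of the pairs loses nothing, since each unordered
    pair is listed in one orientation only. *)
Lemma uniq_pairs_sets (T : finType) (s : seq T) :
  uniq s -> uniq [seq ([set e.1; e.2])%SET | e <- pairs s].
Proof.
elim: s => //= v s IH /andP[vs us]; rewrite map_cat cat_uniq IH// andbT.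
rewrite -map_comp; apply/andP; split.
  rewrite map_inj_in_uniq// => a b sa sb /= /setP/(_ a).
  rewrite !inE eqxx orbT; case/esym/predU1P => [av|/eqP//].
  by rewrite -av sa in vs.
apply/hasPn => _ /mapP[e /mem_pairs/andP[e1 e2] ->].
apply/mapP => -[u _ /= /setP/(_ v)]; rewrite !inE eqxx /= => /pred2P ve.
by case: ve vs => ->; rewrite ?e1 ?e2.
Qed.

(** An edge is listed exactly once among the pairs, in one of its two
    orientations, so sets of edges are counted by counting pairs. *)
Lemma card_edges_pairs (V : finType) (G : sgraph V) (s : seq V)
    (Q : pred {set V}) : uniq s -> (forall v, v \in s) ->
  #|[set e in edges G | Q e]%SET| =
  count (fun e => adj G e.1 e.2 && Q [set e.1; e.2]%SET) (pairs s).
Proof.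
move=> us sV; pose r := [seq e <- pairs s | adj G e.1 e.2 && Q [set e.1; e.2]%SET].
have ur : uniq [seq ([set e.1; e.2])%SET | e <- r].
  apply: subseq_uniq (uniq_pairs_sets us).
  by apply: map_subseq; exact: filter_subseq.
rewrite -size_filter -/r -(size_map (fun e => [set e.1; e.2]%SET)) -(card_uniqP ur).
apply: eq_card => e; rewrite !inE.
apply/andP/mapP => [[/imsetP[[a b]]]|[[a b]]].
  rewrite inE /= => ab -> Qab.
  have nab : a != b by apply: contraTneq ab => ->; rewrite adj_irr.
  case/orP: (pairs_total (sV a) (sV b) nab) => abs.
    by exists (a, b); rewrite // mem_filter abs ab Qab.
  have ba : [set b; a]%SET = [set a; b]%SET by rewrite finset.setUC.
    by exists (b, a); rewrite //= mem_filter abs /= adj_sym ab ba Qab.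
rewrite mem_filter => /andP[/andP[/= ab Qab] _] ->; split => //.
by apply/imsetP; exists (a, b); rewrite ?inE.
Qed.

Lemma card_edges (V : finType) (G : sgraph V) (s : seq V) :
  uniq s -> (forall v, v \in s) ->
  #|edges G| = count (fun e => adj G e.1 e.2) (pairs s).
Proof.
move=> us sV; have -> : edges G = [set e in edges G | predT e]%SET.
  by apply/setP => e; rewrite inE andbT.
by rewrite (card_edges_pairs _ _ us sV); apply: eq_count => e; rewrite andbT.
Qed.

Lemma edge_adj (V : finType) (G : sgraph V) (a b : V) :
  ([set a; b]%SET \in edges G) = adj G a b.
Proof.
apply/imsetP/idP => [[[u v]]|ab]; last by exists (a, b); rewrite ?inE.
rewrite inE /= => uv abuv.
have nuv : u != v by apply: contraTneq uv => ->; rewrite adj_irr.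
have /setP/(_ u) := abuv; have /setP/(_ v) := abuv.
rewrite !inE !eqxx orbT /= => /pred2P[] va /pred2P[] ub; subst => //.
- by rewrite eqxx in nuv.
- by rewrite adj_sym.
- by rewrite eqxx in nuv.
Qed.

Lemma mono_edges_pairs (V : finType) (G : sgraph V) (s : seq V) (x : V -> nat) :
  uniq s -> (forall v, v \in s) ->
  mono_edges G x =
  count (fun e => adj G e.1 e.2 && (x e.1 == x e.2)) (pairs s).
Proof.
move=> us sV; rewrite /mono_edges (card_edges_pairs _ _ us sV).
apply: eq_count => -[a b] /=; congr (_ && _).
apply/forall_inP/eqP => [|xab u].
  by move/(_ a (set21 _ _))/forall_inP/(_ b (set22 _ _))/eqP.
by case/set2P => ->; apply/forall_inP => v /set2P[] ->; rewrite ?xab.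
Qed.

End Pairs.

(** * Listing the vertices by increasing degree *)

Section Degrees.
Variables (V : finType) (e : rel V).
Hypotheses (e_sym : symmetric e) (e_irr : irreflexive e).

Definition degree (v : V) : nat := (\sum_(u : V) e v u)%N.

Fixpoint sum_sq_backdegree (s : seq V) : nat :=
  if s is v :: s' then (count (e v) s' ^ 2 + sum_sq_backdegree s')%N else 0%N.

(** The handshake lemma, within the listed vertices. *)
Lemma handshake_pairs (s : seq V) :
  (\sum_(v <- s) \sum_(u <- s) e v u = 2 * count (fun q => e q.1 q.2) (pairs s))%N.
Proof.
elim: s => [|v s IH]; first by rewrite big_nil.
rewrite big_cons big_cons e_irr add0n /= count_cat count_map.
under [X in (_ + X)%N]eq_bigr do rewrite big_cons.
rewrite big_split /= IH.
have -> : count (preim (pair v) (fun q => e q.1 q.2)) s = (\sum_(u <- s) e v u)%N.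
  by rewrite -sum1_count big_mkcond; apply: eq_bigr => u _ /=; case: (e v u).
under [X in (_ + (X + _))%N]eq_bigr do rewrite e_sym.
lia.
Qed.

(** A neighbour listed after [v] has degree at least that of [v], which is at
    least the number [d] of such neighbours; so [d ^ 2] is at most the sum of
    all degrees. *)
Lemma backdegree_sorted (v : V) (s : seq V) :
  uniq s -> {in s, forall u, degree v <= degree u}%N ->
  (count (e v) s ^ 2 <= \sum_u degree u)%N.
Proof.
move=> us degs.
have sumT (F : V -> nat) : (\sum_(u <- s) F u <= \sum_u F u)%N.
  by rewrite (big_uniq _ us) big_mkcond; apply: leq_sum => u _; case: ifP.
have countE : (count (e v) s = \sum_(u <- s) e v u)%N.
  by rewrite -sum1_count big_mkcond; apply: eq_bigr => u _; case: (e v u).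
have dv : (count (e v) s <= degree v)%N by rewrite countE sumT.
apply: leq_trans (sumT degree).
rewrite -mulnn {1}countE big_distrl /= !big_seq; apply: leq_sum => u us'.
by case: (e v u); rewrite ?mul1n ?mul0n// (leq_trans dv (degs u us')).
Qed.

(** Each backdegree is at most the square root of the sum of all degrees, and
    the backdegrees add up to the number of edges. *)
Lemma sum_sq_backdegree_sorted (R : realType) (s : seq V) :
  uniq s -> sorted (fun u v => degree u <= degree v)%N s ->
  (sum_sq_backdegree s)%:R <=
  Num.sqrt (\sum_u degree u)%N%:R * (count (fun q => e q.1 q.2) (pairs s))%:R :> R.
Proof.
elim: s => [_ _|v s IH /= /andP[_ us] vs]; first by rewrite mulr0.
have leT : transitive (fun u v => degree u <= degree v)%N.
  by move=> ? ? ?; exact: leq_trans.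
have := IH us (path_sorted vs).
rewrite natrD count_cat natrD count_map mulrDr => {}IH.
apply: lerD => //.
have degs : {in s, forall u, degree v <= degree u}%N.
  by apply/allP; exact: order_path_min leT vs.
have -> : count (preim (pair v) (fun q => e q.1 q.2)) s = count (e v) s by [].
rewrite natrX expr2 ler_wpM2r//.
rewrite -[leLHS]ger0_norm// -sqrtr_sqr ler_wsqrtr// -natrX ler_nat.
exact: backdegree_sorted.
Qed.

Definition degree_order : seq V :=
  sort (fun u v => degree u <= degree v)%N (enum V).

Lemma degree_order_uniq : uniq degree_order.
Proof. by rewrite sort_uniq enum_uniq. Qed.

Lemma mem_degree_order v : v \in degree_order.
Proof. by rewrite mem_sort mem_enum. Qed.

Lemma degree_order_sorted :
  sorted (fun u v => degree u <= degree v)%N degree_order.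
Proof. by apply: sort_sorted => u v; exact: leq_total. Qed.

End Degrees.

(** * Monochromatic edges versus independent trials *)

Section MarkedTotal.
Variables (V : eqType) (S : nmodType) (e : rel V) (t : V -> V -> S).

Definition marked_total (K : eqType) (s : seq V) (x : V -> K) : S :=
  \sum_(q <- pairs s | e q.1 q.2 && (x q.1 == x q.2)) t q.1 q.2.

Definition marks (s : seq V) : seq S :=
  [seq t q.1 q.2 | q <- pairs s & e q.1 q.2].

Lemma marked_total_inj (K K' : eqType) (g : K -> K') (s : seq V) (x : V -> K) :
  injective g -> marked_total s (g \o x) = marked_total s x.
Proof. by move=> ginj; apply: eq_bigl => q; rewrite /= inj_eq. Qed.

End MarkedTotal.

Section MainBound.
Variables (R : realType) (V C : finType) (S : nmodType).
Variables (e : rel V) (t : V -> V -> S).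
Hypothesis C_gt0 : (0 < #|C|)%N.
Let p : R := #|C|%:R^-1.

(** Induction on the listing: the head [v] is the last vertex to be coloured, so
    the edges among the others do not see its colour, and [attach_vertex] applies
    with these edges as the base. *)
Lemma lindeberg_backdegrees (s : seq V) (f : S -> R) (M : R) :
  uniq s -> (forall a, `|f a| <= M) ->
  `|avg (fun x : {ffun V -> C} => f (marked_total e t s x)) - thins p (marks e t s) f 0|
  <= 4 * M * p ^+ 2 * (sum_sq_backdegree e s)%:R.
Proof.
have p01 : 0 <= p <= 1 by rewrite invr_ge0 ler0n /= invf_le1 ?ltr0n// ler1n.
have col0 : (0 < #|{ffun V -> C}|)%N by rewrite card_ffun expn_gt0 C_gt0.
elim: s f => [f _ fM|v s IH f /= /andP[vs us] fM].
  rewrite (eq_avg (_ : _ =1 fun=> f 0)); last first.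
    by move=> x; rewrite /marked_total big_nil.
  by rewrite avg_cst// subrr normr0 mulr0.
set N := [seq u <- s | e v u].
rewrite (_ : marks e t (v :: s) = map (t v) N ++ marks e t s); last first.
  rewrite /marks /= filter_cat map_cat filter_map -map_comp.
  by congr (_ ++ _).
rewrite thins_cat.
have step : `|avg (fun x : {ffun V -> C} => f (marked_total e t (v :: s) x)) -
    avg (fun x : {ffun V -> C} => thins p (map (t v) N) f (marked_total e t s x))|
    <= 4 * M * p ^+ 2 * (size N)%:R ^+ 2.
  (* Resample the colour of [v], which the edges within [s] do not see. *)
  rewrite (avg_recolor v)//.
  rewrite (eq_avg (_ : _ =1 fun x : {ffun V -> C} => avg (fun j : C =>
      f (marked_total e t s x + \sum_(w <- N | x w == j) t v w)))); last first.
    move=> x; apply: eq_avg => j; congr f.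
    rewrite /marked_total /= big_cat [RHS]addrC /=; congr (_ + _); last first.
      rewrite big_seq_cond [RHS]big_seq_cond; apply: eq_bigl => q.
      apply: andb_id2l => /mem_pairs/andP[q1 q2].
      by rewrite !recolor_other//; apply: contraNneq vs => <-.
    rewrite big_map [in RHS]big_filter_cond /= big_seq_cond [RHS]big_seq_cond.
    apply: eq_bigl => w; apply: andb_id2l => ws.
    rewrite recolor_same recolor_other 1?eq_sym//.
    by apply: contraNneq vs => ->.
  by apply: attach_vertex => //; exact: filter_uniq.
apply: le_trans (ler_distD _ _ _) _.
apply: le_trans (lerD step (IH _ us (thins_bounded p01 _ fM))) _.
by rewrite -mulrDr natrD natrX size_filter.
Qed.

Hypotheses (e_sym : symmetric e) (e_irr : irreflexive e).

Theorem lindeberg_edges (f : S -> R) (M m : R) :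
  let s := degree_order e in
  (forall a, `|f a| <= M) ->
  m = (count (fun q => e q.1 q.2) (pairs s))%:R ->
  `|avg (fun x : {ffun V -> C} => f (marked_total e t s x)) -
    thins p (marks e t s) f 0|
  <= 4 * M * p ^+ 2 * (Num.sqrt (2 * m) * m).
Proof.
move=> s fM mE; have us : uniq s := degree_order_uniq e.
have sV v : v \in s := mem_degree_order e v.
apply: le_trans (lindeberg_backdegrees us fM) _.
have M0 : 0 <= M by exact: le_trans (fM 0).
rewrite ler_wpM2l ?mulr_ge0 ?exprn_ge0 ?invr_ge0//.
have -> : 2 * m = (\sum_u degree e u)%N%:R.
  rewrite mE -natrM -handshake_pairs//; congr (_%:R).
  have sumT F : (\sum_(v <- s) F v = \sum_v F v)%N.
    by rewrite (big_uniq _ us); apply: eq_bigl => v; rewrite sV.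
  by rewrite sumT; apply: eq_bigr => v _; exact: sumT.
rewrite mE; apply: sum_sq_backdegree_sorted => //; exact: degree_order_sorted.
Qed.

End MainBound.

(** * Independent trials on product test functions *)

Section ProductTestFunctions.
Variables (R : realType) (p : R).

(** A mark that is a basis vector moves a single coordinate, so the operators
    act separately on the three factors. *)
Lemma thins_tensor (ts : seq (nat * nat * nat)) (g1 g2 g3 : nat -> R) :
  all (mem [:: (1, 0, 0); (0, 1, 0); (0, 0, 1)])%N ts ->
  thins p ts (fun s => g1 s.1.1 * g2 s.1.2 * g3 s.2) 0 =
  iter (count_mem (1, 0, 0)%N ts) (thin p 1%N) g1 0%N *
  iter (count_mem (0, 1, 0)%N ts) (thin p 1%N) g2 0%N *
  iter (count_mem (0, 0, 1)%N ts) (thin p 1%N) g3 0%N.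
Proof.
elim: ts g1 g2 g3 => [//|t ts IH] g1 g2 g3 /= /andP[+ /IH{}IH].
rewrite !inE => /or3P[] /eqP ->; rewrite ?add0n ?add1n -?iterS ?iterSr -IH;
  congr thins; apply/funext => -[[a b] c] /=;
  by rewrite /thin /= ?addr0; ring.
Qed.

Lemma iter_thin_pmf0 (m b s : nat) : (b < s)%N ->
  iter m (thin p 1%N) (fun n => (n == b)%:R) s = 0.
Proof.
elim: m s => [|m IH] s bs; first by rewrite /= gtn_eqF.
by rewrite iterS /thin !IH ?mulr0 ?addr0// addrC ltnS ltnW.
Qed.

Lemma binomial_pmfE (m a : nat) :
  binomial_pmf m p a = 'C(m, a)%:R * (p ^+ a * (1 - p) ^+ (m - a)).
Proof. by rewrite mulr_natl. Qed.

(** Pascal's rule.  The shift [s] is needed for the induction, because a success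
    moves the starting point. *)
Lemma iter_thin_pmf (m a s : nat) :
  iter m (thin p 1%N) (fun n => (n == a + s)%N%:R) s = binomial_pmf m p a.
Proof.
rewrite binomial_pmfE; elim: m a s => [|m IH] a s.
  rewrite /= -[X in X == _]add0n eqn_add2r.
  by case: a => [|a]; rewrite bin0n ?expr0 ?mulr1 ?mul0r.
have s1 : s + 1 = s.+1 by exact: addn1.
rewrite iterS {1}/thin IH s1; case: a => [|a].
  rewrite iter_thin_pmf0 //.
  by rewrite !bin0 !subn0 [in RHS]exprS; ring.
under eq_fun do rewrite addSnnS.
rewrite IH subSS binS natrD.
have [am|ma] := ltnP a m.
  by rewrite -(subnSK am) !exprS; ring.
by rewrite bin_small// exprS; ring.
Qed.

End ProductTestFunctions.

(** * The Poisson limit of binomial masses *)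

Section BinomialToPoisson.
Variables (R : realType) (m c : nat -> nat) (mu : R).
Hypotheses (c_infty : c n @[n --> \oo] --> \oo)
  (m_over_c : ((m n)%:R / (c n)%:R : R) @[n --> \oo] --> mu).

Lemma near_gt0 (k : nat) : \forall n \near \oo, (k < c n)%N.
Proof. by move/cvgnyPgt : c_infty; apply. Qed.

Lemma cvg_inv_colors : ((c n)%:R^-1 : R) @[n --> \oo] --> 0.
Proof.
apply/gtr0_cvgV0; last exact/cvgrnyP.
by near=> n; rewrite ltr0n; near: n; exact: near_gt0.
Unshelve. all: by end_near. Qed.

Lemma cvg_subn_over (k : nat) :
  ((m n - k)%N%:R / (c n)%:R : R) @[n --> \oo] --> mu.
Proof.
have lower : ((m n)%:R / (c n)%:R - k%:R * (c n)%:R^-1 : R) @[n --> \oo] --> mu.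
  rewrite -[mu]subr0 -(mulr0 k%:R); apply: cvgB => //.
  by apply: cvgM; [exact: cvg_cst|exact: cvg_inv_colors].
apply: (squeeze_cvgr _ lower m_over_c); near=> n.
rewrite -mulrBl !ler_wpM2r ?invr_ge0//; first by rewrite ler_nat leq_subr.
by rewrite lerBlDr -natrD ler_nat; lia.
Unshelve. all: by end_near. Qed.

Lemma cvg_ffact_over (k : nat) :
  ((m n ^_ k)%:R / (c n)%:R ^+ k : R) @[n --> \oo] --> mu ^+ k.
Proof.
elim: k => [|k IH].
  by under eq_fun do rewrite ffactn0 expr0 divr1; exact: cvg_cst.
rewrite exprSr; under eq_fun do rewrite ffactnSr natrM exprSr invfM mulrACA.
by apply: cvgM => //; exact: cvg_subn_over.
Qed.

(** Squeezed between exponentials by [1 - p <= exp (- p)] and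
    [(1 - p)^-1 = 1 + p / (1 - p) <= exp (p / (1 - p))]. *)
Lemma cvg_no_success (k : nat) :
  ((1 - (c n)%:R^-1 : R) ^+ (m n - k)) @[n --> \oo] --> expR (- mu).
Proof.
have upper : expR (- ((m n - k)%N%:R / (c n)%:R : R)) @[n --> \oo] --> expR (- mu).
  apply: continuous_cvg; first exact: continuous_expR.
  by apply: cvgN; exact: cvg_subn_over.
have lower : expR (- ((m n - k)%N%:R / (c n)%:R * (1 - (c n)%:R^-1)^-1 : R))
    @[n --> \oo] --> expR (- mu).
  apply: continuous_cvg; first exact: continuous_expR.
  have q1 : (1 - (c n)%:R^-1 : R) @[n --> \oo] --> (1 : R).
    rewrite -[X in _ --> X]subr0.
    by apply: cvgB; [exact: cvg_cst|exact: cvg_inv_colors].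
  apply: cvgN; rewrite -[mu]mulr1 -[X in mu * X]invr1.
  apply: cvgM; first exact: cvg_subn_over.
  by apply: cvgV => //; exact: oner_neq0.
apply: (squeeze_cvgr _ lower upper); near=> n.
have c1 : (1 < c n)%N by near: n; exact: near_gt0.
have c0 : 0 < (c n)%:R :> R by rewrite ltr0n ltnW.
set p : R := (c n)%:R^-1.
have p0 : 0 < p by rewrite invr_gt0.
have q0 : 0 < 1 - p by rewrite subr_gt0 invf_lt1// ltr1n.
rewrite -mulrA -!mulrN !expRM_natl.
apply/andP; split; apply: lerXn2r; rewrite ?nnegrE ?expR_ge0 ?(ltW q0)//.
  rewrite mulrN expRN -[leRHS]invrK lef_pV2 ?posrE ?invr_gt0 ?expR_gt0//.
  apply: le_trans (expR_ge1Dx _).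
  by rewrite le_eqVlt; apply/orP; left; apply/eqP; field; rewrite lt0r_neq0.
exact: expR_ge1Dx.
Unshelve. all: by end_near. Qed.

Lemma cvg_binomial_poisson (k : nat) :
  binomial_pmf (m n) ((c n)%:R^-1 : R) k @[n --> \oo] -->
  mu ^+ k / k`!%:R * expR (- mu).
Proof.
have -> : (fun n => binomial_pmf (m n) ((c n)%:R^-1 : R) k) =
    (fun n => (m n ^_ k)%:R / (c n)%:R ^+ k / k`!%:R *
              (1 - (c n)%:R^-1) ^+ (m n - k)).
  apply/funext => n; rewrite binomial_pmfE -bin_ffact natrM exprVn.
  set y := (_ ^+ k)^-1; set z := (1 - _) ^+ _.
  by field; rewrite pnatr_eq0 -lt0n fact_gt0.
apply: cvgM; last exact: cvg_no_success.
by apply: cvgM; [exact: cvg_ffact_over|exact: cvg_cst].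
Qed.

End BinomialToPoisson.

(** * Convergence in law on a countable set *)

Section DiscreteLaws.
Variable R : realType.

Section OneVariable.
Variables (d : measure_display) (T : measurableType d) (P : probability T R).
Variables (S : countType) (Z : T -> S).
Hypothesis mZ : forall s, measurable (Z @^-1` [set s]).

Lemma measurable_preimage_countable (B : set S) : measurable (Z @^-1` B).
Proof.
have -> : Z @^-1` B = \bigcup_(s : S) (if `[<B s>] then Z @^-1` [set s] else set0).
  apply/seteqP; split => [w /= BZ|w [s _]].
    by exists (Z w) => //; case: asboolP.
  by case: asboolP => // Bs /= ->.
apply: countable_bigcupT_measurable => [|s]; first exact: countableP.
by case: ifP => // _; exact: measurable0.
Qed.

Lemma measurable_comp_countable (F : S -> R) : measurable_fun setT (F \o Z).
Proof.
by move=> _ Y _; rewrite setTI comp_preimage; exact: measurable_preimage_countable.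
Qed.

Lemma integrable_comp_countable (F : S -> R) (M : R) :
  (forall s, `|F s| <= M) -> P.-integrable setT (EFin \o (F \o Z)).
Proof.
move=> FM; apply: measurable_bounded_integrable => //.
- by rewrite (le_lt_trans (probability_le1 _ _)) ?ltry.
- exact: measurable_comp_countable.
- exists M; split; first exact: num_real.
  by move=> K MK w _; exact: le_trans (FM _) (ltW MK).
Qed.

Lemma expectation_countableE (F : S -> R) (M : R) :
  (forall s, `|F s| <= M) ->
  ('E_P[F \o Z])%E = (\int[P]_w F (Z w))%:E.
Proof.
move=> FM; rewrite expectation.unlock /Rintegral fineK//.
exact: (integrable_fin_num _ (integrable_comp_countable FM)).
Qed.

Lemma Rintegral_pred1 (s : S) :
  \int[P]_w (Z w == s)%:R = fine (P (Z @^-1` [set s])).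
Proof.
rewrite /Rintegral -[X in P X]setIT -integral_indic//.
congr fine; apply: eq_integral => w _; rewrite indicE.
congr ((nat_of_bool _)%:R%:E).
by apply/eqP/idP => [?|/set_mem//]; exact/mem_set.
Qed.

(** The two sides differ by the integral of [F \o Z] over the event that [Z]
    misses the list [r]. *)
Lemma expectation_truncation (F : S -> R) (M : R) (r : seq S) :
  uniq r -> (forall s, `|F s| <= M) ->
  `|\int[P]_w F (Z w) - \sum_(s <- r) F s * fine (P (Z @^-1` [set s]))|
  <= M * (1 - \sum_(s <- r) fine (P (Z @^-1` [set s]))).
Proof.
move=> ur FM.
have intF (G : S -> R) K : (forall s, `|G s| <= K) ->
    P.-integrable setT (EFin \o (fun w => G (Z w))).
  exact: integrable_comp_countable.
have int1 := Rintegral_pred1.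
have b1 (s : S) : forall u : S, `|(u == s)%:R : R| <= 1.
  by move=> u; case: eqP; rewrite ?normr0 ?normr1.
(* [hit G l] is [G] restricted to the list [l], written as a sum of indicators. *)
pose hit (G : S -> R) (l : seq S) u := \sum_(s <- l) G s * (u == s)%:R.
have hit_bounded G l u : `|hit G l u| <= \sum_(s <- l) `|G s|.
  apply: le_trans (ler_norm_sum _ _ _) _; apply: ler_sum => s _.
  by rewrite normrM ler_piMr.
have int_hit G l : \int[P]_w hit G l (Z w) =
    \sum_(s <- l) G s * fine (P (Z @^-1` [set s])).
  elim: l => [|s l IH].
    under eq_Rintegral do rewrite /hit big_nil.
    by rewrite big_nil Rintegral_cst// mul0r.
  rewrite big_cons -IH -int1 -RintegralZl//; last exact: intF (b1 s).
  rewrite -RintegralD//.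
  - by apply: eq_Rintegral => w _; rewrite /hit big_cons.
  - apply: (intF (fun u => G s * (u == s)%:R) `|G s|) => u.
    by rewrite normrM ler_piMr.
  - exact: intF (hit_bounded G l).
have hitE G u : hit G r u = if u \in r then G u else 0.
  case: ifPn => [ur'|nur].
    rewrite /hit (bigD1_seq u)//= eqxx mulr1 big1 ?addr0// => s su.
    by rewrite eq_sym (negbTE su) mulr0.
  rewrite /hit big_seq big1// => s sr.
  by case: eqP nur => [->|]; rewrite ?sr ?mulr0.
have intFZ := intF F M FM.
rewrite -int_hit -RintegralB//; last exact: intF (hit_bounded F r).
apply: le_trans (le_normr_Rintegral _ _) _ => //.
  apply: (intF (fun u => F u - hit F r u) (M + \sum_(s <- r) `|F s|)) => u.
  by rewrite (le_trans (ler_normB _ _))// lerD.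
have miss_bounded u : `|1 - hit (cst 1) r u| <= 1 + \sum_(s <- r) `|1 : R|.
  by apply: le_trans (ler_normB _ _) (lerD _ (hit_bounded (cst 1) r u)); rewrite normr1.
have -> : M * (1 - \sum_(s <- r) fine (P (Z @^-1` [set s]))) =
    \int[P]_w (M * (1 - hit (cst 1) r (Z w))).
  rewrite RintegralZl//; last exact: intF miss_bounded.
  rewrite RintegralB//; last 2 first.
  - by apply: (intF (cst 1) 1) => u; rewrite normr1.
  - exact: intF (hit_bounded (cst 1) r).
  rewrite int_hit Rintegral_cst// (congr1 fine (probability_setT P)) mulr1.
  by congr (_ * (_ - _)); apply: eq_bigr => s _; rewrite mul1r.
apply: le_Rintegral => //.
- apply: (intF (fun u => `|F u - hit F r u|) (M + \sum_(s <- r) `|F s|)) => u.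
  by rewrite normr_id (le_trans (ler_normB _ _))// lerD.
- apply: (intF (fun u => M * (1 - hit (cst 1) r u))
    (`|M| * (1 + \sum_(s <- r) `|1 : R|))) => u.
  by rewrite normrM ler_wpM2l.
move=> w _; rewrite !hitE; case: ifP => _; first by rewrite !subrr normr0 mulr0.
by rewrite !subr0 mulr1.
Qed.

Lemma preimage_seq_prob (r : seq S) : uniq r ->
  fine (P (Z @^-1` [set` r])) = \sum_(s <- r) fine (P (Z @^-1` [set s])).
Proof.
elim: r => [_|s r IH /= /andP[sr ur]].
  by rewrite set_nil preimage_set0 measure0 big_nil.
have -> : [set` s :: r] = [set s] `|` [set` r].
  apply/seteqP; split => u /=; rewrite inE; first by case/predU1P; [left|right].
  by case=> [->|->]; rewrite ?eqxx ?orbT.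
rewrite big_cons -IH// preimage_setU measureU.
- by rewrite fineD// fin_num_measure//; exact: measurable_preimage_countable.
- exact: mZ.
- exact: measurable_preimage_countable.
- apply/seteqP; split => // w [/= -> sr']; by rewrite sr' in sr.
Qed.

(** Continuity of the measure from below, along an enumeration of [S]. *)
Lemma truncation_exists (e : R) : 0 < e ->
  exists2 r : seq S, uniq r & 1 - e < \sum_(s <- r) fine (P (Z @^-1` [set s])).
Proof.
move=> e0; pose r n := undup (pmap (@pickle_inv S) (iota 0 n)).
pose A n : set T := Z @^-1` [set` r n].
have mA n : measurable (A n) by exact: measurable_preimage_countable.
have memr n u : (u \in r n) = (pickle u < n)%N.
  rewrite mem_undup mem_pmap; apply/mapP/idP => [[i]|un].
    rewrite mem_iota /= add0n => ni /esym iu.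
    by have /= := pickle_invK (T := S) i; rewrite iu /= => ->.
  by exists (pickle u); rewrite ?pickleK_inv// mem_iota.
have AT : \bigcup_n A n = setT.
  apply/seteqP; split => // w _; exists (pickle (Z w)).+1 => //.
  by rewrite /A /= memr.
have incA : {homo A : n m / (n <= m)%N >-> (n <= m)%O}.
  move=> n k nk; apply/subsetPset => w; rewrite /A /= !memr => wn.
  exact: leq_trans wn nk.
have PA : P (A n) @[n --> \oo] --> 1%E.
  rewrite -(probability_setT P) -AT; apply: nondecreasing_cvg_mu => //.
  by rewrite AT; exact: measurableT.
have : fine (P (A n)) @[n --> \oo] --> (1 : R).
  by apply: fine_cvg; exact: PA.
move=> /cvgrPdist_lt/(_ e e0)[n _ /(_ n (leqnn n))] /= Pn.
exists (r n); first exact: undup_uniq.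
have <- : fine (P (A n)) = \sum_(s <- r n) fine (P (Z @^-1` [set s])).
  by apply: preimage_seq_prob; exact: undup_uniq.
by move: Pn; rewrite ltr_norml; lra.
Qed.

End OneVariable.

(** Tightness of the limit law makes the truncation to a fixed finite list
    uniformly accurate, so no mass escapes. *)
Lemma cvg_discrete_laws (S : countType)
    (d : nat -> measure_display) (T : forall n, measurableType (d n))
    (P : forall n, probability (T n) R) (Z : forall n, T n -> S)
    (d' : measure_display) (T' : measurableType d') (P' : probability T' R)
    (Z' : T' -> S) :
  (forall n s, measurable (Z n @^-1` [set s])) ->
  (forall s, measurable (Z' @^-1` [set s])) ->
  (forall s, fine (P n (Z n @^-1` [set s])) @[n --> \oo] -->
    fine (P' (Z' @^-1` [set s]))) ->
  forall (F : S -> R) (M : R), (forall s, `|F s| <= M) ->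
  \int[P n]_w F (Z n w) @[n --> \oo] --> \int[P']_w F (Z' w).
Proof.
move=> mZ mZ' cvgZ F M0 FM0; pose M := `|M0| + 1.
have FM s : `|F s| <= M.
  by rewrite (le_trans (FM0 s))// (le_trans (ler_norm _))// lerDl.
have Mgt0 : 0 < M by rewrite ltr_wpDl.
have cvg_list (G : S -> R) (r : seq S) :
    \sum_(s <- r) G s * fine (P n (Z n @^-1` [set s])) @[n --> \oo] -->
    \sum_(s <- r) G s * fine (P' (Z' @^-1` [set s])).
  elim: r => [|s r IH].
    by rewrite big_nil; under eq_fun do rewrite big_nil; exact: cvg_cst.
  rewrite big_cons; under eq_fun do rewrite big_cons.
  by apply: cvgD => //; apply: cvgM => //; exact: cvg_cst.
apply/cvgrPdist_lt => e e0.
(* The budget [e] is spent as [e / 4] on the sums over [r], [e / 4] on truncating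
   the limit law, and [e / 2] on truncating the law of [Z n], which misses at most
   [e / 4 / M] more mass outside [r] than the limit law does. *)
have d0 : 0 < e / 4 / M by rewrite !divr_gt0.
have [r ur rP] := truncation_exists P' mZ' d0.
have /cvgrPdist_lt/(_ _ d0) mass := cvg_list (fun=> 1) r.
have e4 : 0 < e / 4 by rewrite divr_gt0.
have /cvgrPdist_lt/(_ _ e4) close := cvg_list F r.
near=> n.
have massn : `|\sum_(s <- r) 1 * fine (P' (Z' @^-1` [set s])) -
   \sum_(s <- r) 1 * fine (P n (Z n @^-1` [set s]))| < e / 4 / M by near: n.
have closen : `|\sum_(s <- r) F s * fine (P' (Z' @^-1` [set s])) -
   \sum_(s <- r) F s * fine (P n (Z n @^-1` [set s]))| < e / 4 by near: n.
have := expectation_truncation P' mZ' ur FM.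
have := expectation_truncation (P n) (mZ n) ur FM.
move: massn closen rP; under eq_bigr do rewrite mul1r.
under [X in `|_ - X|]eq_bigr do rewrite mul1r.
set a := \sum_(s <- r) fine _; set b := \sum_(s <- r) fine _.
set A := \sum_(s <- r) F s * _; set B := \sum_(s <- r) F s * _.
have eM : e / 4 / M * M = e / 4 by rewrite divfK// gt_eqF.
have Ma : M * (1 - e / 4 / M) = M - e / 4 by rewrite mulrBr mulr1 mulrC eM.
set q := e / 4 / M in eM Ma *.
rewrite !ltr_norml !ler_norml => /andP[m1 m2] /andP[c1 c2] ra.
have := ltr_pM2l Mgt0 (1 - q) a; rewrite ra => Mra.
have := ltr_pM2l Mgt0 (a - b) q; rewrite m2 => Mab.
move=> /andP[x1 x2] /andP[y1 y2]; apply/andP; lra.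
Unshelve. all: by end_near. Qed.

End DiscreteLaws.

(** * Random colourings as uniform averages *)

Section UniformColoring.
Variables (R : realType) (d : measure_display) (T : measurableType d).
Variables (P : probability T R) (V : finType) (c : nat).
Variable X : V -> {RV P >-> nat}.
Hypotheses (c_gt0 : (0 < c)%N) (X_unif : uniform_coloring c X).

Definition coloring (w : T) : {ffun V -> nat} := [ffun v => X v w].

(** Random colours range over 1, ..., c, whereas ['I_c] starts at 0. *)
Definition shift_coloring (x : {ffun V -> 'I_c}) : {ffun V -> nat} :=
  [ffun v => (x v).+1].

Lemma coloring_preimage (x : {ffun V -> nat}) :
  coloring @^-1` [set x] =
  \bigcap_(v in [set` [set: V]%SET]) (X v @^-1` [set x v]).
Proof.
apply/seteqP; split => [w /= <- v _ /=|w /= Xw]; first by rewrite ffunE.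
by apply/ffunP => v; rewrite ffunE; apply: Xw; rewrite /= inE.
Qed.

Lemma measurable_coloring (x : {ffun V -> nat}) :
  measurable (coloring @^-1` [set x]).
Proof.
rewrite coloring_preimage; apply: fin_bigcap_measurable => // v _.
by rewrite -[X in measurable X]setTI; exact: measurable_funPT.
Qed.

Lemma coloring_prob (x : {ffun V -> 'I_c}) :
  fine (P (coloring @^-1` [set shift_coloring x])) =
  #|{ffun V -> 'I_c}|%:R^-1.
Proof.
have [unif indep] := X_unif.
rewrite coloring_preimage indep//.
rewrite (eq_bigr (fun=> (c%:R^-1)%:E)); last first.
  by move=> v _; rewrite ffunE; have := unif v (x v).+1; rewrite /= ltn_ord.
rewrite prodEFin /= prodr_const cardsT card_ffun card_ord natrX exprVn.
by [].
Qed.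

(** The colourings with colours in 1, ..., c carry the whole mass, so
    [expectation_truncation] along them has no error. *)
Lemma expectation_coloring (F : {ffun V -> nat} -> R) (M : R) :
  (forall x, `|F x| <= M) ->
  \int[P]_w F (coloring w) =
  avg (fun x : {ffun V -> 'I_c} => F (shift_coloring x)).
Proof.
move=> FM; pose r := [seq shift_coloring x | x : {ffun V -> 'I_c}].
have inj : injective shift_coloring.
  move=> x y /ffunP xy; apply/ffunP => v; apply/val_inj.
  by have := xy v; rewrite !ffunE => -[].
have ur : uniq r by rewrite map_inj_uniq ?enum_uniq.
have := expectation_truncation P measurable_coloring ur FM.
have sumE (G : {ffun V -> nat} -> R) :
    \sum_(s <- r) G s * fine (P (coloring @^-1` [set s])) =
    avg (fun x : {ffun V -> 'I_c} => G (shift_coloring x)).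
  rewrite big_map big_enum /avg mulr_sumr; apply: eq_bigr => x _.
  by rewrite coloring_prob mulrC.
have mass : \sum_(s <- r) fine (P (coloring @^-1` [set s])) = 1.
  transitivity (\sum_(s <- r) 1 * fine (P (coloring @^-1` [set s]))).
    by apply: eq_bigr => s _; rewrite mul1r.
  by rewrite (sumE (cst 1)) avg_cst// card_ffun card_ord expn_gt0 c_gt0.
rewrite mass sumE subrr mulr0 normr_le0 subr_eq0 => /eqP//.
Qed.

End UniformColoring.

(** * The three kinds of edges of a multiplex *)

Section Multiplex.
Variables (V : finType) (G1 G2 : sgraph V).

Definition union_adj : rel V := [rel u v | adj G1 u v || adj G2 u v].

Lemma union_adj_sym : symmetric union_adj.
Proof. by move=> u v; rewrite /union_adj /= adj_sym [adj G2 _ _]adj_sym. Qed.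

Lemma union_adj_irr : irreflexive union_adj.
Proof. by move=> u; rewrite /union_adj /= !adj_irr. Qed.

Definition layer_mark (u v : V) : nat * nat * nat :=
  let a := adj G1 u v in let b := adj G2 u v in
  (nat_of_bool (a && ~~ b), nat_of_bool (b && ~~ a), nat_of_bool (a && b)).

Let s := degree_order union_adj.

Definition mono_counts (K : eqType) (x : V -> K) : nat * nat * nat :=
  marked_total union_adj layer_mark s x.

Let us : uniq s := degree_order_uniq _.
Let sV : forall v, v \in s := mem_degree_order _.

Lemma fst_sum (A B : nmodType) (I : Type) (r : seq I) (Q : pred I)
    (F : I -> A * B) :
  (\sum_(i <- r | Q i) F i).1 = \sum_(i <- r | Q i) (F i).1.
Proof. by apply: (big_morph fst). Qed.

Lemma snd_sum (A B : nmodType) (I : Type) (r : seq I) (Q : pred I)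
    (F : I -> A * B) :
  (\sum_(i <- r | Q i) F i).2 = \sum_(i <- r | Q i) (F i).2.
Proof. by apply: (big_morph snd). Qed.

Lemma mono_edges1 (x : V -> nat) :
  mono_edges G1 x = ((mono_counts x).1.1 + (mono_counts x).2)%N.
Proof.
rewrite (mono_edges_pairs G1 x us sV) /mono_counts /marked_total.
rewrite !fst_sum snd_sum -[RHS]big_split /= -sum1_count.
rewrite big_mkcond [RHS]big_mkcond; apply: eq_bigr => -[u v] _ /=.
rewrite /union_adj /=.
by case: (adj G1 u v); case: (adj G2 u v); case: (x u == x v).
Qed.

Lemma mono_edges2 (x : V -> nat) :
  mono_edges G2 x = ((mono_counts x).1.2 + (mono_counts x).2)%N.
Proof.
rewrite (mono_edges_pairs G2 x us sV) /mono_counts /marked_total.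
rewrite fst_sum !snd_sum -[RHS]big_split /= -sum1_count.
rewrite big_mkcond [RHS]big_mkcond; apply: eq_bigr => -[u v] _ /=.
rewrite /union_adj /=.
by case: (adj G1 u v); case: (adj G2 u v); case: (x u == x v).
Qed.

Lemma card_common_edges :
  #|edges G1 :&: edges G2| =
  count (fun q => adj G1 q.1 q.2 && adj G2 q.1 q.2) (pairs s).
Proof.
have -> : edges G1 :&: edges G2 = [set e in edges G1 | e \in edges G2]%SET.
  by apply/setP => e; rewrite !inE.
rewrite (card_edges_pairs G1 (mem (edges G2)) us sV).
by apply: eq_count => q /=; rewrite edge_adj.
Qed.

Let count_split (T : Type) (a b c' : pred T) (l : seq T) :
  (forall q, (a q : nat) = b q + c' q)%N -> count a l = (count b l + count c' l)%N.
Proof. by move=> abc; elim: l => //= q l ->; rewrite abc; lia. Qed.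

Lemma count_only1 :
  count_mem (1, 0, 0)%N (marks union_adj layer_mark s) =
  (#|edges G1| - #|edges G1 :&: edges G2|)%N.
Proof.
rewrite (card_edges G1 us sV) card_common_edges count_map count_filter.
rewrite (@count_split _ (fun q => adj G1 q.1 q.2)
  (fun q => adj G1 q.1 q.2 && adj G2 q.1 q.2)
  (fun q => adj G1 q.1 q.2 && ~~ adj G2 q.1 q.2)) => [|q].
  rewrite addnC addnK; apply: eq_count => q /=.
  by rewrite /layer_mark /union_adj /=; case: (adj G1 _ _); case: (adj G2 _ _).
by case: (adj G1 _ _); case: (adj G2 _ _).
Qed.

Lemma count_only2 :
  count_mem (0, 1, 0)%N (marks union_adj layer_mark s) =
  (#|edges G2| - #|edges G1 :&: edges G2|)%N.
Proof.
rewrite (card_edges G2 us sV) card_common_edges count_map count_filter.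
rewrite (@count_split _ (fun q => adj G2 q.1 q.2)
  (fun q => adj G1 q.1 q.2 && adj G2 q.1 q.2)
  (fun q => adj G2 q.1 q.2 && ~~ adj G1 q.1 q.2)) => [|q].
  rewrite addnC addnK; apply: eq_count => q /=.
  by rewrite /layer_mark /union_adj /=; case: (adj G1 _ _); case: (adj G2 _ _).
by case: (adj G1 _ _); case: (adj G2 _ _).
Qed.

Lemma count_both :
  count_mem (0, 0, 1)%N (marks union_adj layer_mark s) =
  #|edges G1 :&: edges G2|.
Proof.
rewrite card_common_edges count_map count_filter; apply: eq_count => q /=.
by rewrite /layer_mark /union_adj /=; case: (adj G1 _ _); case: (adj G2 _ _).
Qed.

Lemma layer_marks_basis :
  all (mem [:: (1, 0, 0); (0, 1, 0); (0, 0, 1)])%N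
    (marks union_adj layer_mark s).
Proof.
rewrite all_map; apply/allP => q; rewrite mem_filter => /andP[/= + _].
rewrite /layer_mark /union_adj /=; by case: (adj G1 _ _); case: (adj G2 _ _).
Qed.

Lemma count_union :
  (count (fun q => union_adj q.1 q.2) (pairs s) <= #|edges G1| + #|edges G2|)%N.
Proof.
rewrite (card_edges G1 us sV) (card_edges G2 us sV).
rewrite -count_predUI; apply: leq_trans (leq_addr _ _).
by apply: sub_count => q.
Qed.

Variables (R : realType) (c : nat).
Hypothesis c_gt0 : (0 < c)%N.
Let p : R := c%:R^-1.

(** [lindeberg_edges] at the indicator of [k], which is a product of three
    indicators, so that the independent trials give a product of binomial masses.
    The number of edges of the union is bounded by [m]. *)
Lemma mono_counts_binomial (k : nat * nat * nat) (m : R) :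
  m = (#|edges G1| + #|edges G2|)%N%:R ->
  `|avg (fun x : {ffun V -> 'I_c} => (mono_counts x == k)%:R) -
    binomial_pmf (#|edges G1| - #|edges G1 :&: edges G2|)%N p k.1.1 *
    binomial_pmf (#|edges G2| - #|edges G1 :&: edges G2|)%N p k.1.2 *
    binomial_pmf #|edges G1 :&: edges G2| p k.2|
  <= 4 * p ^+ 2 * (Num.sqrt (2 * m) * m).
Proof.
move=> mE; pose f (a : nat * nat * nat) : R := (a == k)%:R.
have f1 a : `|f a| <= 1 by rewrite /f; case: eqP; rewrite ?normr0 ?normr1.
have C0 : (0 < #|'I_c|)%N by rewrite card_ord.
have := lindeberg_edges layer_mark C0 union_adj_sym union_adj_irr f1 erefl.
have fE : f = (fun a => (a.1.1 == k.1.1)%:R * (a.1.2 == k.1.2)%:R *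
    (a.2 == k.2)%:R).
  apply/funext => -[[a1 a2] a3]; case: k @f f1 => [[k1 k2] k3] f f1.
  by rewrite /f !xpair_eqE -!mulnb !natrM.
rewrite [in thins _ _ _ _]fE (thins_tensor _ (fun n => (n == k.1.1)%:R)
  (fun n => (n == k.1.2)%:R) (fun n => (n == k.2)%:R) layer_marks_basis).
rewrite count_only1 count_only2 count_both card_ord -/p mulr1.
have pmf a b : iter a (thin p 1%N) (fun n => (n == b)%:R) 0%N = binomial_pmf a p b.
  by rewrite -(iter_thin_pmf p a b 0) addn0.
rewrite !pmf => /le_trans; apply.
rewrite ler_wpM2l ?mulr_ge0 ?exprn_ge0 ?invr_ge0//.
apply: ler_pM; rewrite ?sqrtr_ge0// mE ?ler_nat ?count_union//.
by rewrite ler_wsqrtr// ler_wpM2l// ler_nat count_union.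
Qed.

End Multiplex.

(** * The law of the limit *)

Section PoissonLaw.
Variables (R : realType) (d : measure_display) (T : measurableType d).
Variables (P : probability T R).

(** For [rate = 0] the formula gives the Dirac mass at 0, because [0 ^+ 0 = 1]. *)
Lemma poisson_mass (rate : R) (Z : {RV P >-> nat}) (k : nat) :
  0 <= rate -> is_poisson rate Z ->
  P (Z @^-1` [set k]) = (rate ^+ k / k`!%:R * expR (- rate))%:E.
Proof.
move=> rate0 /(congr1 (fun Q => Q [set k])).
rewrite /distribution /pushforward /poisson_prob => ->.
move: rate0; rewrite le_eqVlt => /predU1P[<-|rate_gt0]; last first.
  by rewrite rate_gt0 esum_set1 ?lee_fin ?poisson_pmf_ge0// /poisson_pmf rate_gt0.
rewrite ltxx oppr0 expR0 mulr1 diracE.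
case: k => [|k]; first by rewrite mem_set// expr0 fact0 divr1.
by rewrite memNset ?expr0n ?mul0r.
Qed.

Lemma independent_triple (Z1 Z2 Z3 : {RV P >-> nat}) (k : nat * nat * nat) :
  mutually_independent (tnth [tuple Z1; Z2; Z3]) ->
  P ((fun w => (Z1 w, Z2 w, Z3 w)) @^-1` [set k]) =
  (P (Z1 @^-1` [set k.1.1]) * P (Z2 @^-1` [set k.1.2]) *
   P (Z3 @^-1` [set k.2]))%E.
Proof.
move=> indep; case: k => [[k1 k2] k3] /=.
pose B : 'I_3 -> set nat := tnth [tuple [set k1]; [set k2]; [set k3]].
have := indep [set: 'I_3]%SET B (fun=> I).
rewrite (eq_bigl xpredT); last by move=> i; rewrite inE.
rewrite !big_ord_recl big_ord0 mule1 muleA => <-; congr (P _).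
apply/seteqP; split => w /=.
  by case=> e1 e2 e3 [[|[|[|//]]]] i3 _.
move=> Zw; congr (_, _, _).
- by have := Zw ord0; rewrite /= inE; apply.
- by have := Zw (lift ord0 ord0); rewrite /= inE; apply.
- by have := Zw (lift ord0 (lift ord0 ord0)); rewrite /= inE; apply.
Qed.

End PoissonLaw.

(** * Convergence of the counts *)

Lemma mono_counts_shift (V : finType) (G1 G2 : sgraph V) (c : nat)
    (x : {ffun V -> 'I_c}) :
  mono_counts G1 G2 (shift_coloring x) = mono_counts G1 G2 x.
Proof.
rewrite /mono_counts -[RHS](marked_total_inj _ _ _ _ (g := fun i : 'I_c => i.+1)).
  by congr marked_total; apply/funext => v; rewrite ffunE.
by move=> i j [] /val_inj.
Qed.

(** With [m / c] convergent, [sqrt (2 (m / c) / c) * 4 (m / c)] is a null factor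
    times a bounded one. *)
Lemma cvg_lindeberg_error (R : realType) (m c : nat -> nat) (mu : R) :
  c n @[n --> \oo] --> \oo ->
  ((m n)%:R / (c n)%:R : R) @[n --> \oo] --> mu ->
  (4 * (c n)%:R^-1 ^+ 2 * (Num.sqrt (2 * (m n)%:R) * (m n)%:R) : R)
    @[n --> \oo] --> (0 : R).
Proof.
move=> c_infty mc.
have -> : (fun n => 4 * (c n)%:R^-1 ^+ 2 * (Num.sqrt (2 * (m n)%:R) * (m n)%:R) : R) =
    (fun n => Num.sqrt (2 * ((m n)%:R / (c n)%:R) * (c n)%:R^-1) *
       (4 * ((m n)%:R / (c n)%:R))).
  apply/funext => n; set p := (c n)%:R^-1.
  have -> : 2 * ((m n)%:R * p) * p = 2 * (m n)%:R * p ^+ 2 by ring.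
  rewrite [in RHS]sqrtrM ?mulr_ge0// sqrtr_sqr ger0_norm ?invr_ge0//; ring.
have -> : (0 : R) = Num.sqrt (2 * mu * 0) * (4 * mu).
  by rewrite mulr0 sqrtr0 mul0r.
apply: cvgM; last by apply: cvgM => //; exact: cvg_cst.
apply: continuous_cvg; first exact: sqrt_continuous.
apply: cvgM; last exact: cvg_inv_colors.
by apply: cvgM => //; exact: cvg_cst.
Qed.

Unset Implicit Arguments.

Theorem mainTheorem6 (R : realType)
    (H : nat -> multiplex2) (c : nat -> nat)
    (* the random coloring of the n-th multiplex *)
    (d : nat -> measure_display) (Omega : forall n, measurableType (d n))
    (P : forall n, probability (Omega n) R)
    (X : forall n, vertices (H n) -> {RV (P n) >-> nat})
    (hX : forall n, uniform_coloring (c n) (X n))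
    (hc : c n @[n --> \oo] --> \oo)
    (lambda1 lambda2 lambda12 : R)
    (h1 : 0 <= lambda1) (h2 : 0 <= lambda2) (h12 : 0 <= lambda12)
    (h12_1 : lambda12 <= lambda1) (h12_2 : lambda12 <= lambda2)
    (hE1 : (#|edges (layer1 (H n))|%:R / (c n)%:R : R) @[n --> \oo]
             --> lambda1)
    (hE2 : (#|edges (layer2 (H n))|%:R / (c n)%:R : R) @[n --> \oo]
             --> lambda2)
    (hE12 : (#|edges (layer1 (H n)) :&: edges (layer2 (H n))|%:R / (c n)%:R : R)
              @[n --> \oo] --> lambda12)
    (* the limiting variables *)
    (d' : measure_display) (Omega' : measurableType d')
    (P' : probability Omega' R)
    (Z1 Z2 Z12 : {RV P' >-> nat})
    (hZ1 : is_poisson (lambda1 - lambda12) Z1)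
    (hZ2 : is_poisson (lambda2 - lambda12) Z2)
    (hZ12 : is_poisson lambda12 Z12)
    (hZ : mutually_independent (tnth [tuple Z1; Z2; Z12])) :
  cvg_in_distribution P
    (fun n (w : Omega n) =>
       ((mono_edges (layer1 (H n)) (fun v => X n v w))%:R,
        (mono_edges (layer2 (H n)) (fun v => X n v w))%:R) : R * R)
    P'
    (fun w : Omega' => ((Z1 w + Z12 w)%:R, (Z2 w + Z12 w)%:R) : R * R).
Proof.
move=> f _ [M fM].
pose G1 n := layer1 (H n); pose G2 n := layer2 (H n).
pose cnt n (w : Omega n) := mono_counts (G1 n) (G2 n) (coloring (X n) w).
pose lim w := (Z1 w, Z2 w, Z12 w).
pose F (k : nat * nat * nat) : R :=
  f ((k.1.1 + k.2)%N%:R, (k.1.2 + k.2)%N%:R).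
have FM k : `|F k| <= M by exact: fM.
have mcnt n k : measurable (cnt n @^-1` [set k]).
  exact: (measurable_preimage_countable (measurable_coloring (X n))
    [set y | mono_counts (G1 n) (G2 n) y = k]).
have mlim k : measurable (lim @^-1` [set k]).
  have -> : lim @^-1` [set k] =
      Z1 @^-1` [set k.1.1] `&` Z2 @^-1` [set k.1.2] `&` Z12 @^-1` [set k.2].
    case: k => [[k1 k2] k3]; apply/seteqP; split => w /=.
      by case=> <- <- <-.
    by rewrite /lim => -[[-> ->] ->].
  by apply: measurableI; [apply: measurableI|];
    rewrite -[X in measurable X]setTI; exact: measurable_funPT.
have -> : (fun n => 'E_(P n)[f \o (fun w =>
      ((mono_edges (layer1 (H n)) (fun v => X n v w))%:R,
       (mono_edges (layer2 (H n)) (fun v => X n v w))%:R) : R * R)])%E =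
    (fun n => (\int[P n]_w F (cnt n w))%:E).
  apply/funext => n; rewrite -(expectation_countableE (P n) (mcnt n) FM).
  congr expectation; apply/funext => w /=.
  have colE : (coloring (X n) w : vertices (H n) -> nat) = (fun v => X n v w).
    by apply/funext => v; rewrite ffunE.
  by rewrite /F /cnt colE (mono_edges1 _ (G2 n)) (mono_edges2 (G1 n)).
rewrite [X in _ --> X](_ : _ = (\int[P']_w F (lim w))%:E); last first.
  by rewrite -(expectation_countableE P' mlim FM).
apply: cvg_EFin; first by apply: nearW => n.
(* Only the masses of the triple of counts remain to be compared. *)
apply: (cvg_discrete_laws mcnt mlim _ FM) => k.
pose B n : R :=
  binomial_pmf (#|edges (G1 n)| - #|edges (G1 n) :&: edges (G2 n)|)%N
    (c n)%:R^-1 k.1.1 *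
  binomial_pmf (#|edges (G2 n)| - #|edges (G1 n) :&: edges (G2 n)|)%N
    (c n)%:R^-1 k.1.2 *
  binomial_pmf #|edges (G1 n) :&: edges (G2 n)| (c n)%:R^-1 k.2.
pose m n := (#|edges (G1 n)| + #|edges (G2 n)|)%N.
pose err n : R := 4 * (c n)%:R^-1 ^+ 2 * (Num.sqrt (2 * (m n)%:R) * (m n)%:R).
have err0 : err n @[n --> \oo] --> (0 : R).
  apply: (@cvg_lindeberg_error _ m c (lambda1 + lambda2)) => //.
  under eq_fun do rewrite natrD mulrDl.
  exact: cvgD.
have diff_cvg (a b : nat -> nat) (x y : R) : (forall n, b n <= a n)%N ->
    ((a n)%:R / (c n)%:R : R) @[n --> \oo] --> x ->
    ((b n)%:R / (c n)%:R : R) @[n --> \oo] --> y ->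
    ((a n - b n)%N%:R / (c n)%:R : R) @[n --> \oo] --> x - y.
  move=> ba ax bx; under eq_fun do rewrite natrB// mulrBl.
  exact: cvgB.
have Bcvg : B n @[n --> \oo] --> fine (P' (lim @^-1` [set k])).
  rewrite (independent_triple k hZ).
  rewrite (poisson_mass _ _ hZ1) ?subr_ge0// (poisson_mass _ _ hZ2) ?subr_ge0//.
  rewrite (poisson_mass _ _ hZ12)// -!EFinM /=.
  apply: cvgM; [apply: cvgM|]; apply: cvg_binomial_poisson => //.
  - by apply: diff_cvg => // n; rewrite subset_leq_card// subsetIl.
  - by apply: diff_cvg => // n; rewrite subset_leq_card// subsetIr.
have close n : (0 < c n)%N ->
    `|fine (P n (cnt n @^-1` [set k])) - B n| <= err n.
  move=> c0; rewrite -(Rintegral_pred1 (P n) (mcnt n)).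
  rewrite (expectation_coloring (F := fun y => (mono_counts (G1 n) (G2 n) y == k)%:R)
    c0 (hX n) (M := 1)); last first.
    by move=> y; case: eqP; rewrite ?normr0 ?normr1.
  under eq_avg do rewrite mono_counts_shift.
  exact: mono_counts_binomial.
have lower : (B n - err n) @[n --> \oo] --> fine (P' (lim @^-1` [set k])).
  by rewrite -[X in _ --> X]subr0; apply: cvgB.
have upper : (B n + err n) @[n --> \oo] --> fine (P' (lim @^-1` [set k])).
  by rewrite -[X in _ --> X]addr0; apply: cvgD.
apply: (squeeze_cvgr _ lower upper); near=> n.
have := close n; rewrite ler_norml => /(_ _)/andP[].
  by near: n; exact: near_gt0.
by move=> ? ?; apply/andP; lra.
Unshelve. all: by end_near. Qed.
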